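(* Let $G$ be a finite group, let $\chi\in\mathrm{Irr}(G)$, and let $N$ be a normal subgroup of $G$. If the restriction $\chi_N$ is irreducible, then the graphs $\mathcal C_G(\chi)$ and $\mathcal C_N(\chi)$ (which have the same vertex set) have the same connected components, i.e. two vertices are connected by a path in $\mathcal C_G(\chi)$ if and only if they are connected by a path in $\mathcal C_N(\chi)$.
   Context: All groups are finite. $\mathrm{Irr}(G)$ denotes the set of irreducible complex characters of $G$. A character pair in $G$ is a pair $(A,\alpha)$ where $A$ is a subgroup of $G$ and $\alpha\in\mathrm{Irr}(A)$. For a subgroup $A\subseteq G$, $\alpha^G$ denotes the induced character and $\chi_A$ the restriction. Clifford correspondent: if $C\vartriangleleft A$, $\alpha\in\mathrm{Irr}(A)$, $\gamma\in\mathrm{Irr}(C)$ is a constituent of $\alpha_C$, and $B$ is the stabilizer of $\gamma$ in $A$ (under the conjugation action of $A$ on $\mathrm{Irr}(C)$), then the Clifford correspondent of $\alpha$ with respect to $\gamma$ is the unique $\beta\in\mathrm{Irr}(B)$ such that $\gamma$ is a constituent of $\beta_C$ and $\beta^A=\alpha$. The graph $\mathcal C_N(\chi)$: for $\chi\in\mathrm{Irr}(G)$ and $N\vartriangleleft G$, $\mathcal C_N(\chi)$ is the undirected graph whose vertices are the character pairs $(A,\alpha)$ in $G$ with $\alpha^G=\chi$, and whose edges are formed by joining each vertex $(A,\alpha)$ with each other vertex $(B,\beta)$ for which there exists a character pair $(C,\gamma)$ such that: (1) $C\vartriangleleft A$ and $C\subseteq N$; (2) $B$ is the stabilizer of $\gamma$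 in $A$; (3) $\beta$ is the Clifford correspondent of $\alpha$ with respect to $\gamma$ (in particular $\gamma$ is a constituent of $\alpha_C$). The graph $\mathcal C_G(\chi)$ is the case $N=G$ of this definition. *)

(* Defs.v *)
From HB Require Import structures.
From mathcomp Require Import all_boot all_order all_fingroup all_algebra.
From mathcomp Require Import all_solvable all_field all_character.

Set Implicit Arguments.
Unset Strict Implicit.
Unset Printing Implicit Defensive.

Local Open Scope group_scope.
Local Open Scope ring_scope.

(* A character pair (A, alpha): alpha is given by its index i in Irr(A), i.e.,
   alpha = 'chi[A]_i. A priori A is any subgroup of the ambient type gT; the
   pairs in a group G are those with A \subset G. *)
Definition char_pair (gT : finGroupType) : Type :=
  {A : {group gT} & Iirr A}.

Definition pair_group (gT : finGroupType) (P : char_pair gT) : {group gT} :=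
  tag P.

Definition pair_char (gT : finGroupType) (P : char_pair gT) :
    'CF(pair_group P) :=
  'chi_(tagged P).

(* The explicit A \subset G matters: 'Ind[G, A] is total and takes a junk value
   when A is not a subgroup of G. *)
Definition clifford_vertices (gT : finGroupType) (G : {group gT})
    (chi : 'CF(G)) : {set char_pair gT} :=
  [set P | (pair_group P \subset G) && ('Ind[G] (pair_char P) == chi)].

(* "beta is the Clifford correspondent of alpha with respect to gamma" is
   rendered by its defining properties: by Clifford's theorem they determine
   the pair beta from the pairs alpha and gamma. *)
Definition is_clifford_correspondent (gT : finGroupType)
    (alpha gamma beta : char_pair gT) : bool :=
  let A := pair_group alpha in
  let B := pair_group beta in
  let C := pair_group gamma in
  [&& C <| A,
      tagged gamma \in irr_constt ('Res[C] (pair_char alpha)),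
      B == 'I_A[pair_char gamma]%G,
      tagged gamma \in irr_constt ('Res[C] (pair_char beta))
    & 'Ind[A] (pair_char beta) == pair_char alpha].

Definition clifford_step (gT : finGroupType) (N : {group gT})
    (alpha beta : char_pair gT) : bool :=
  [exists gamma : char_pair gT,
     (pair_group gamma \subset N)
     && is_clifford_correspondent alpha gamma beta].

(* The adjacency relation of the undirected graph C_N(chi). *)
Definition clifford_graph (gT : finGroupType) (G : {group gT})
    (chi : 'CF(G)) (N : {group gT}) : rel (char_pair gT) :=
  fun P Q =>
    [&& P \in clifford_vertices chi, Q \in clifford_vertices chi, P != Q
      & clifford_step N P Q || clifford_step N Q P].

(* Main.v *)
(* Suppose (B, b) comes from (A, a) by Clifford correspondence over a pair
   (C, c), where C need not lie in N. Put D = C :&: N and let d be a constituent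
   of c on D. Taking Clifford correspondents over d, which is allowed in C_N,
   moves (A, a) and (B, b) to pairs (A1, a1) and (B1, b1), and (B1, b1) is then
   the Clifford correspondent of (A1, a1) over a character of the stabilizer of
   d in C. This reduces the claim to the case where d is invariant in A. In that
   case elements of N act on Irr(C | d) through multiplication by functions on
   C / D, so their actions commute and the stabilizer of c in N is normal in N.
   Since a is irreducible on A :&: N, comparing degrees gives A = B (A :&: N) and
   shows that S = B :&: N is normal in A, that b is irreducible on S, and that B
   is the stabilizer of b_S in A: the pairs are joined directly over (S, b_S). *)
Require Import Defs.
From HB Require Import structures.
From mathcomp Require Import all_boot all_order all_fingroup all_algebra.
From mathcomp Require Import all_solvable all_field all_character.

Set Implicit Arguments.
Unset Strict Implicit.
Unset Printing Implicit Defensive.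

Local Open Scope group_scope.
Local Open Scope ring_scope.

Import Order.TTheory GRing.Theory Num.Theory.

(** * Conjugation action on the characters lying over an invariant character *)

Section CommutingConjugation.

Variable gT : finGroupType.
Implicit Types G C D F N : {group gT}.

(** By Frobenius reciprocity ['chi_l] occurs in the character induced from ['Res[D] 'chi_k], which
    is ['Ind[F, D] 1 * 'chi_k]. As [F / D] is abelian, every constituent of ['Ind[F, D] 1] is linear
    with [D] in its kernel. *)
Lemma constt_Res_eq_mul_lin F D (d : Iirr D) (k l : Iirr F) :
    D <| F -> F^`(1)%g \subset D ->
    d \in irr_constt ('Res[D] 'chi_k) -> d \in irr_constt ('Res[D] 'chi_l) ->
  exists2 lam : 'CF(F), lam \is a linear_char /\ D \subset cfker lam
    & 'chi_l = lam * 'chi_k.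
Proof.
move=> nsDF sF'D kd ld.
have: l \in irr_constt ('Ind[F] ('Res[D] 'chi_k)).
  have [r Nr ->] := constt_charP d (cfRes_char D (irr_char k)) kd.
  rewrite linearD /= irr_consttE cfdotDl.
  rewrite gt_eqF // ltr_pwDl ?natr_ge0 ?Cnat_cfdot_char ?cfInd_char ?irr_char //.
  rewrite -constt_Ind_Res irr_consttE in ld.
  by rewrite natr_gt0 // Cnat_cfdot_char ?cfInd_char ?irr_char.
rewrite -['Res _]mul1r cfIndM ?normal_sub // ['Ind _]cfun_sum_constt mulr_suml.
rewrite irr_consttE cfdot_suml => nz_sum.
have [i Fi nz_i]: exists2 i, i \in irr_constt ('Ind[F, D] 1)
    & '['['Ind[F, D] 1, 'chi_i] *: 'chi_i * 'chi_k, 'chi_l] != 0.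
  apply/exists_inP; apply: contraR nz_sum => /exists_inPn z_sum.
  by rewrite big1 // => i /z_sum; rewrite negbK => /eqP.
have kerDi: D \subset cfker 'chi_i.
  by rewrite constt0_Res_cfker // -constt_Ind_Res irr0.
have lin_i: 'chi_i \is a linear_char.
  by rewrite lin_irr_der1 (subset_trans sF'D).
exists 'chi_i => //.
have /irrP[j Dj]: 'chi_i * 'chi_k \in irr F by rewrite mul_lin_irr ?mem_irr.
move: nz_i; rewrite -scalerAl cfdotZl mulf_eq0 negb_or Dj cfdot_irr => /andP[_].
by case: (j =P l) => [-> | _] //; rewrite eqxx.
Qed.

(* Both conjugates are multiples of 'chi_k by linear characters of F / D, and N
   fixes these because it centralizes F / D. *)
Lemma cfConjg_comm_abelian_quotient F D N (d : Iirr D) (k : Iirr F) :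
    D <| F -> F^`(1)%g \subset D -> [~: F, N] \subset D -> N \subset 'I['chi_d] ->
    d \in irr_constt ('Res[D] 'chi_k) ->
  {in N &, forall n m, (('chi_k ^ n) ^ m)%CF = (('chi_k ^ m) ^ n)%CF}.
Proof.
move=> nsDF sF'D sFND INd kd.
have nFN: N \subset 'N(F) by rewrite -commg_subl (subset_trans sFND) ?normal_sub.
have conjE n: n \in N -> exists2 lam : 'CF(F),
      lam \is a linear_char /\ D \subset cfker lam
    & ('chi_k ^ n)%CF = lam * 'chi_k.
  move=> Nn; rewrite -conjg_IirrE; apply: (constt_Res_eq_mul_lin nsDF sF'D kd).
  have Idn := subsetP INd n Nn.
  rewrite conjg_IirrE -cfConjgRes_norm ?(subsetP nFN) //; last first.
    by rewrite (subsetP (norm_inertia 'chi_d)).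
  by rewrite irr_consttE -{1}(inertiaJ Idn) cfConjg_iso.
have fix_lam n (lam : 'CF(F)) :
    n \in N -> D \subset cfker lam -> (lam ^ n)%CF = lam.
  move=> Nn kerD; apply/cfun_inP => x Fx; rewrite cfConjgE ?(subsetP nFN) //.
  (* Conjugating [x] multiplies it by a commutator in [[~: F, N]], hence by an element of the kernel
     of [lam]. *)
  rewrite conjg_mulR cfkerMr // (subsetP kerD) // (subsetP sFND) //.
  by rewrite mem_commg ?groupV.
move=> n m Nn Nm.
have [[ln [_ kn] En] [lm [_ km] Em]] := (conjE n Nn, conjE m Nm).
by rewrite En Em !rmorphM /= En Em !fix_lam // mulrCA.
Qed.

Lemma Res_invariant_constt C D (d : Iirr D) (c : Iirr C) :
    D <| C -> C \subset 'I['chi_d] -> d \in irr_constt ('Res[D] 'chi_c) ->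
  'Res[D] 'chi_c = '['Res[D] 'chi_c, 'chi_d] *: 'chi_d.
Proof.
move=> nsDC ICd cd.
by rewrite {1}(Clifford_Res_sum_cfclass nsDC cd) cfclass_invariant ?big_seq1.
Qed.

Lemma constt_Res_invariant C F D (d : Iirr D) (c : Iirr C) (k : Iirr F) :
    D <| C -> C \subset 'I['chi_d] -> D \subset F -> F \subset C ->
    d \in irr_constt ('Res[D] 'chi_c) -> k \in irr_constt ('Res[F] 'chi_c) ->
  d \in irr_constt ('Res[D] 'chi_k).
Proof.
move=> nsDC ICd sDF sFC cd ck.
have [l kl] := constt_cfRes_irr D k.
have := constt_Res_trans (cfRes_char F (irr_char c)) ck kl.
rewrite cfResRes // (Res_invariant_constt nsDC ICd cd) irr_consttE cfdotZl.
rewrite mulf_eq0 cfdot_irr pnatr_eq0 eqb0 negb_or negbK => /andP[_ /eqP->].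
exact: kl.
Qed.

(** [C / D] need not be abelian, but two class functions can be compared one element at a time: at
    [x] it suffices to restrict to [D <*> <[x]>], which is cyclic modulo [D] and normalized by [N],
    and to treat each constituent there. *)
Lemma cfConjg_comm_invariant C N D (d : Iirr D) (c : Iirr C) :
    C :&: N = D -> N \subset 'N(C) -> C \subset 'N(N) ->
    C \subset 'I['chi_d] -> N \subset 'I['chi_d] ->
    d \in irr_constt ('Res[D] 'chi_c) ->
  {in N &, forall n m, (('chi_c ^ n) ^ m)%CF = (('chi_c ^ m) ^ n)%CF}.
Proof.
move=> defD nCN nNC ICd INd cd n m Nn Nm.
have sDC: D \subset C by rewrite -defD subsetIl.
have nsDC: D <| C by rewrite /normal sDC -defD normsI ?normG.
have sCND: [~: C, N] \subset D by rewrite -defD subsetI commg_subl commg_subr nCN.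
apply/cfun_inP => x Cx; pose F := (D <*> <[x]>)%G.
have sxC: <[x]> \subset C by rewrite cycle_subG.
have [nDx sDF] := (subset_trans sxC (normal_norm nsDC), joing_subl D <[x]>).
have sFC: F \subset C by rewrite join_subG sDC.
have Fx: x \in F by rewrite mem_gen // inE cycle_id orbT.
have nsDF: D <| F by rewrite (normalS sDF sFC).
have sF'D: F^`(1)%g \subset D.
  rewrite der1_min ?normal_norm //= quotientYidl //.
  by rewrite quotient_abelian ?cycle_abelian.
have sFND: [~: F, N] \subset D by rewrite (subset_trans (commSg _ sFC)).
have nFN: N \subset 'N(F) by rewrite -commg_subl (subset_trans sFND).
have resE y z : y \in N -> z \in N ->
    (('chi_c ^ y) ^ z)%CF x = \sum_(k in irr_constt ('Res[F] 'chi_c))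
      '['Res[F] 'chi_c, 'chi_k] * (('chi_k ^ y) ^ z)%CF x.
  move=> Ny Nz; rewrite -(cfResE _ sFC Fx).
  rewrite -!cfConjgRes_norm ?(subsetP nFN) ?(subsetP nCN) //.
  rewrite {1}['Res _]cfun_sum_constt !linear_sum sum_cfunE.
  by apply: eq_bigr => k _; rewrite !linearZ cfunE.
rewrite !resE //; apply: eq_bigr => k ck; congr (_ * _).
rewrite (cfConjg_comm_abelian_quotient nsDF sF'D sFND INd) //.
exact: constt_Res_invariant cd ck.
Qed.

(** If [x] fixes ['chi_c], commuting the actions of [n^-1] and [x] shows that [x ^ n] fixes it as
    well. *)
Lemma Inertia_normal_invariant C N D (d : Iirr D) (c : Iirr C) :
    C :&: N = D -> N \subset 'N(C) -> C \subset 'N(N) ->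
    C \subset 'I['chi_d] -> N \subset 'I['chi_d] ->
    d \in irr_constt ('Res[D] 'chi_c) ->
  'I_N['chi_c] <| N.
Proof.
move=> defD nCN nNC ICd INd cd.
have comm := cfConjg_comm_invariant defD nCN nNC ICd INd cd.
rewrite /normal subsetIl; apply/subsetP=> n Nn; rewrite inE.
apply/subsetP=> _ /imsetP[x /setIP[Nx Ix] ->].
have [nCn nCx] := (subsetP nCN n Nn, subsetP nCN x Nx).
have nCnV := groupVr nCn.
rewrite inE groupJ // inE groupJ //= conjgE !cfConjgMnorm ?groupM //.
have /= := comm n^-1%g x (groupVr Nn) Nx; rewrite (inertiaJ Ix) => ->.
by rewrite cfConjgKV.
Qed.

End CommutingConjugation.

(** * Irreducible induced characters and stabilizers *)

Section InducedIrreducible.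

Variable gT : finGroupType.
Implicit Types G C D H N S T : {group gT}.

Lemma constt_char1_eq G (i : Iirr G) (phi : 'CF(G)) :
    phi \is a character -> i \in irr_constt phi -> phi 1%g <= 'chi_i 1%g ->
  phi = 'chi_i.
Proof.
move=> Nphi /(constt_charP _ Nphi)[r Nr ->].
rewrite cfunE gerDl => r1_le0; suffices /eqP->: r == 0 by rewrite addr0.
by rewrite -char1_eq0 // eq_le r1_le0 char1_ge0.
Qed.

(** For a constituent [i] of [phi], the character induced from ['chi_i] must contain the irreducible
    ['Ind[G] phi], so [phi] has degree at most that of ['chi_i]. *)
Lemma cfInd_irr_irr G H (phi : 'CF(H)) :
  H \subset G -> phi \is a character -> 'Ind[G] phi \in irr G -> phi \in irr H.
Proof.
move=> sHG Nphi /irrP[j Ej].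
have nz_phi: phi != 0 by rewrite -(cfInd_eq0 sHG) // Ej irr_neq0.
have [i phi_i] := neq0_has_constt nz_phi.
rewrite (constt_char1_eq Nphi phi_i) ?mem_irr //.
have [r Nr Ephi] := constt_charP _ Nphi phi_i.
have [k ik] := constt_cfInd_irr i sHG.
have: k \in irr_constt ('Ind[G] phi).
  rewrite Ephi linearD /= irr_consttE cfdotDl gt_eqF // ltr_pwDl //.
    by rewrite natr_gt0 // Cnat_cfdot_char ?cfInd_char ?irr_char.
  by rewrite natr_ge0 ?Cnat_cfdot_char ?cfInd_char ?irr_char.
rewrite Ej constt_irr inE => /eqP Ekj; rewrite {k}Ekj in ik.
rewrite -(ler_pM2l (gt0CiG G H)) -!cfInd1 // Ej.
by rewrite char1_ge_constt ?cfInd_char ?irr_char.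
Qed.

(** By Mackey, the norm of the induced character is the index of [S] in the stabilizer, so norm 1
    forces equality. *)
Lemma Inertia_cfInd_irr S N (s : Iirr S) :
  S <| N -> 'Ind[N] 'chi_s \in irr N -> 'I_N['chi_s] = S.
Proof.
move=> nsSN irr_sN; apply/eqP; rewrite eq_sym eqEcard sub_Inertia ?normal_sub //=.
have := irrWnorm irr_sN; rewrite -cfdot_Res_r cfResInd // cfdotZr cfdot_sumr.
under eq_bigr => y Ny do rewrite (cfdot_irr_conjg _ nsSN Ny).
rewrite -natr_sum fmorphV rmorph_nat -big_mkcondr sum1_card.
move/(canRL (mulVKf (neq0CG S)))/eqP; rewrite mulr1 eqr_nat => /eqP <-.
by apply/eq_leq/eq_card => y; rewrite [RHS]unfold_in !in_setI andbA andbb.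
Qed.

(* Comparing degrees: chi(1) = |G : T| b(1) and, for s a constituent of the
   restriction of b to T :&: N, chi(1) <= |N : T :&: N| s(1). *)
Lemma cfInd_Res_normal_irr G N T (b : Iirr T) :
    N <| G -> T \subset G -> 'Res[N] ('Ind[G] 'chi_b) \in irr N ->
  [/\ (T * N)%g = G, 'Res[T :&: N] 'chi_b \in irr (T :&: N)
    & 'Ind[N] ('Res[T :&: N] 'chi_b) \in irr N].
Proof.
move=> /andP[sNG nNG] sTG irr_chiN; pose S := (T :&: N)%G.
have [sST sSN] : S \subset T /\ S \subset N by rewrite subsetIl subsetIr.
set chi := 'Ind[G] 'chi_b in irr_chiN.
have Nchi: chi \is a character by rewrite cfInd_char ?irr_char.
have /irrP[j Ej] := irr_chiN.
have [s bs] := constt_cfRes_irr S b.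
have chiTb: b \in irr_constt ('Res[T] chi).
  rewrite irr_consttE cfdot_Res_l cfnorm_eq0.
  by rewrite cfInd_eq0 ?irr_char ?irr_neq0.
have sj: j \in irr_constt ('Ind[N] 'chi_s).
  rewrite constt_Ind_Res -Ej cfResRes // -(cfResRes _ sST sTG).
  exact: constt_Res_trans (cfRes_char _ Nchi) chiTb _ bs.
have leS: 'chi_s 1%g <= 'chi_b 1%g.
  by rewrite -(cfRes1 S 'chi_b) char1_ge_constt ?cfRes_char ?irr_char.
have leN: 'chi_j 1%g <= #|N : S|%:R * 'chi_s 1%g.
  by rewrite -cfInd1 // char1_ge_constt ?cfInd_char ?irr_char.
have Ej1: 'chi_j 1%g = #|G : T|%:R * 'chi_b 1%g by rewrite -Ej cfRes1 cfInd1.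
have le_ind: (#|G : T| <= #|N : S|)%N.
  rewrite -(@ler_nat algC) -(ler_pM2r (irr1_gt0 b)) -Ej1 (le_trans leN) //.
  by rewrite ler_wpM2l ?ler0n.
have sTNG: T <*> N \subset G by rewrite join_subG sTG.
have defTN: (T * N)%g = T <*> N by rewrite norm_joinEl ?(subset_trans sTG).
have cardTN: (#|T <*> N| = #|N : S| * #|T|)%N.
  apply/eqP; rewrite -(eqn_pmul2r (cardG_gt0 S)) -defTN -mul_cardG.
  by rewrite mulnAC -(Lagrange sSN) mulnC [(#|S| * _)%N]mulnC.
(* The order of [T <*> N] is [#|N : S| * #|T|], which by [le_ind] is at least that of [G]. *)
have defG: (T * N)%g = G.
  apply/eqP; rewrite defTN eqEcard sTNG cardTN -(Lagrange sTG) mulnC.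
  by rewrite leq_mul2r le_ind orbT.
have eq_ind: #|N : S| = #|G : T|.
  apply/eqP; rewrite -(eqn_pmul2r (cardG_gt0 T)) -cardTN -defTN defG.
  by rewrite mulnC Lagrange.
have Es: 'Res[S] 'chi_b = 'chi_s.
  apply: constt_char1_eq bs _; rewrite ?cfRes_char ?irr_char // cfRes1.
  by rewrite -(ler_pM2l (gt0CiG G T)) -Ej1 -eq_ind.
split=> //; rewrite Es ?mem_irr // (constt_char1_eq _ sj) ?mem_irr //.
  by rewrite cfInd_char ?irr_char.
by rewrite cfInd1 // Ej1 eq_ind ler_wpM2l ?ler0n.
Qed.

Lemma Clifford_correspondent_exists H G (t : Iirr H) (r : Iirr G) :
    H <| G -> t \in irr_constt ('Res[H] 'chi_r) ->
  exists2 s : Iirr 'I_G['chi_t]%G, t \in irr_constt ('Res[H] 'chi_s)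
    & 'Ind[G] 'chi_s = 'chi_r.
Proof.
move=> nsHG rt; have [irrInd _ imInd _ _] := constt_Inertia_bijection t nsHG.
have: r \in irr_constt ('Ind[G] 'chi_t) by rewrite constt_Ind_Res.
rewrite -imInd => /imsetP[s As Er].
by exists s; [rewrite -constt_Ind_Res | rewrite Er cfIirrE ?irrInd].
Qed.

(** ['chi_e] is the Clifford correspondent of ['chi_c] over ['chi_d]. An element [g] fixing ['chi_d]
    carries it to the correspondent of the [g]-conjugate of ['chi_c], so by uniqueness [g] fixes
    both or neither. *)
Lemma Inertia_Clifford_correspondent G C D (d : Iirr D) (c : Iirr C)
    (e : Iirr 'I_C['chi_d]%G) :
    C <| G -> D <| G -> D \subset C ->
    d \in irr_constt ('Res[D] 'chi_e) -> 'Ind[C] 'chi_e = 'chi_c ->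
  'I_('I_G['chi_d])['chi_e] = 'I_('I_G['chi_c])['chi_d].
Proof.
move=> nsCG nsDG sDC ed Ec.
have nsDC: D <| C := normalS sDC (normal_sub nsCG) nsDG.
have [_ injInd _ _ _] := constt_Inertia_bijection d nsDC.
have eA: e \in irr_constt ('Ind 'chi_d) by rewrite constt_Ind_Res.
apply/setP=> g; rewrite !in_setI -!andbA; apply: andb_id2l => Gg.
have nCg := subsetP (normal_norm nsCG) g Gg.
have nDg := subsetP (normal_norm nsDG) g Gg.
rewrite andbC; apply: andb_id2r => Idg.
have nIg: g \in 'N('I_C['chi_d]).
  by rewrite inE conjIg (normP nCg) conjg_inertia // (inertiaJ Idg).
apply/setIdP/setIdP => [] [_ /eqP Eg]; split=> //; apply/eqP.
  by rewrite -Ec cfConjgInd_norm // Eg.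
rewrite -conjg_IirrE; congr 'chi__; apply: injInd => //.
  rewrite constt_Ind_Res conjg_IirrE -cfConjgRes_norm // irr_consttE.
  by have := cfConjg_iso g ('Res[D] 'chi_e) 'chi_d; rewrite (inertiaJ Idg) => ->.
have Ecg: 'Ind[C] 'chi_(conjg_Iirr e g) = 'chi_c.
  by rewrite conjg_IirrE -cfConjgInd_norm // Ec.
by congr cfIirr; rewrite Ecg Ec.
Qed.

(** The reduced case, with [G] and [T] as the groups of the two pairs. [T :&: N] is the stabilizer
    of ['chi_c] in [N], hence normal in [N]; it is also normalized by [T], and [T * N] is [G]. *)
Lemma Inertia_Res_invariant G N C D T (d : Iirr D) (c : Iirr C) (b : Iirr T) :
    N <| G -> C <| G -> C :&: N = D -> T :=: 'I_G['chi_c] ->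
    G \subset 'I['chi_d] -> d \in irr_constt ('Res[D] 'chi_c) ->
    'Res[N] ('Ind[G] 'chi_b) \in irr N ->
  [/\ T :&: N <| G, 'Res[T :&: N] 'chi_b \in irr (T :&: N)
    & 'I_G['Res[T :&: N] 'chi_b] = T].
Proof.
move=> nsNG nsCG defD defT IGd cd irr_chiN.
have [[sNG nNG] [sCG nCG]] := (andP nsNG, andP nsCG).
have sTG: T \subset G by rewrite defT subsetIl.
have [defG irr_s irr_sN] := cfInd_Res_normal_irr nsNG sTG irr_chiN.
have defS: T :&: N = 'I_N['chi_c].
  by rewrite defT setIAC (setIidPr sNG).
have nsSN: T :&: N <| N.
  rewrite defS; apply: Inertia_normal_invariant defD _ _ _ _ cd.
  - exact: subset_trans nCG.
  - exact: subset_trans nNG.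
  - exact: subset_trans IGd.
  exact: subset_trans IGd.
have nST: T \subset 'N(T :&: N) by rewrite normsI ?normG ?(subset_trans sTG).
have nsSG: T :&: N <| G.
  by rewrite /normal subIset ?sTG // -defG mul_subG // normal_norm.
split=> //; have /irrP[s Es] := irr_s.
have sTI: T \subset 'I_G['Res[T :&: N] 'chi_b].
  have sTI_T: T \subset 'I_T['Res[T :&: N] 'chi_b].
    by rewrite (subset_trans _ (sub_inertia_Res 'chi_b nST)) ?sub_Inertia.
  exact: subset_trans sTI_T (setSI _ sTG).
apply/eqP; rewrite eqEsubset sTI andbT.
(* By Dedekind's law the stabilizer is [T] times its intersection with [N]; the latter is [T :&: N]
   because the restriction of ['chi_b] induces irreducibly to [N]. *)
rewrite -(setIidPr (Inertia_sub G _)) -{1}defG -group_modl //=.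
rewrite mul_subG // setIA (setIidPl sNG) Es.
by rewrite (@Inertia_cfInd_irr (T :&: N)%G) -?Es // subsetIl.
Qed.

End InducedIrreducible.

(** * Steps and paths in the Clifford graphs *)

Section CliffordGraph.

Variable gT : finGroupType.
Implicit Types (A B C G N : {group gT}) (P Q : char_pair gT).

Definition mk_pair A (a : Iirr A) : char_pair gT := Tagged (fun A => Iirr A) a.

Lemma clifford_stepI N A B C (a : Iirr A) (b : Iirr B) (c : Iirr C) :
    C \subset N -> C <| A -> B :=: 'I_A['chi_c] ->
    c \in irr_constt ('Res[C] 'chi_a) -> c \in irr_constt ('Res[C] 'chi_b) ->
    'Ind[A] 'chi_b = 'chi_a ->
  clifford_step N (mk_pair a) (mk_pair b).
Proof.
move=> sCN nsCA defB ac bc Ea; apply/existsP; exists (mk_pair c).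
apply/andP; split=> //; apply/and5P; split=> //.
  exact/eqP/val_inj.
exact/eqP.
Qed.

Lemma clifford_step_vertex G N (chi : 'CF(G)) P Q :
    P \in clifford_vertices chi -> clifford_step N P Q ->
  Q \in clifford_vertices chi.
Proof.
rewrite !inE => /andP[sPG /eqP chiP] /existsP[R /andP[_]].
case/and5P=> _ _ /eqP EQ _ /eqP EP.
have sQP: pair_group Q \subset pair_group P by rewrite EQ subsetIl.
by rewrite (subset_trans sQP) //= -(cfIndInd _ sPG sQP) EP chiP.
Qed.

Lemma clifford_graph_sym G N (chi : 'CF(G)) : symmetric (clifford_graph chi N).
Proof. by move=> P Q; rewrite /clifford_graph andbCA eq_sym orbC. Qed.

Lemma connect_clifford_step G N (chi : 'CF(G)) P Q :
    P \in clifford_vertices chi -> clifford_step N P Q ->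
  connect (clifford_graph chi N) P Q.
Proof.
move=> VP PQ; have [-> | neqPQ] := eqVneq P Q; first exact: connect0.
by rewrite connect1 // /clifford_graph VP (clifford_step_vertex VP PQ) neqPQ PQ.
Qed.

Lemma clifford_step_subset N G P Q :
  N \subset G -> clifford_step N P Q -> clifford_step G P Q.
Proof.
move=> sNG /existsP[R /andP[sRN PQ]]; apply/existsP; exists R.
by rewrite (subset_trans sRN).
Qed.

(** The path built runs through [(A, a)], [(A1, a1)], [(B1, b1)] and [(B, b)], the last edge being
    traversed backwards. *)
Lemma clifford_step_connect G N (chi : 'CF(G)) P Q :
    N <| G -> 'Res[N] chi \in irr N -> P \in clifford_vertices chi ->
  clifford_step G P Q -> connect (clifford_graph chi N) P Q.
Proof.
case: P Q => [A a] [B b] nsNG irr_chiN VP /existsP[[C c] /andP[_]].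
rewrite /is_clifford_correspondent /pair_char /pair_group /=.
case/and5P=> nsCA ac /eqP defB bc /eqP Ea; have /andP[sCA nCA] := nsCA.
have := VP; rewrite inE => /andP[/= sAG /eqP /= Echi].
have [sNG nNG] := andP nsNG.
have sBA: B \subset A by rewrite defB subsetIl.
have nsCB: C <| B by rewrite defB normal_Inertia.
have [sCB nCB] := andP nsCB.
pose D := (C :&: N)%G.
have [sDC sDN]: D \subset C /\ D \subset N by rewrite subsetIl subsetIr.
have nsDA: D <| A.
  by rewrite /normal subIset ?sCA // normsI // (subset_trans sAG).
have nsDB: D <| B := normalS (subset_trans sDC sCB) sBA nsDA.
have nsDC: D <| C := normalS sDC sCA nsDA.
have [d cd] := constt_cfRes_irr D c.
have ad: d \in irr_constt ('Res[D] 'chi_a).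
  rewrite -(cfResRes _ sDC sCA).
  exact: constt_Res_trans (cfRes_char C (irr_char a)) ac _ cd.
have bd: d \in irr_constt ('Res[D] 'chi_b).
  rewrite -(cfResRes _ sDC sCB).
  exact: constt_Res_trans (cfRes_char C (irr_char b)) bc _ cd.
have [b1 b1d Eb] := Clifford_correspondent_exists nsDB bd.
set A1 := 'I_A['chi_d]%G; set B1 := 'I_B['chi_d]%G in b1 b1d Eb.
set C1 := 'I_C['chi_d]%G.
have [sA1A sB1B] : A1 \subset A /\ B1 \subset B by rewrite !subsetIl.
have sB1A1: B1 \subset A1 by rewrite setSI.
have sC1B1: C1 \subset B1 by rewrite setSI.
have sDC1: D \subset C1 by rewrite sub_Inertia.
have Ea_b1: 'Ind[A] ('Ind[A1] 'chi_b1) = 'chi_a.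
  by rewrite cfIndInd // -(cfIndInd _ sBA) // Eb.
(* Obtaining [a1] by induction from [b1], rather than as a correspondent of [a], makes the two
   choices compatible. *)
have /irrP[a1 Ea1]: 'Ind[A1] 'chi_b1 \in irr A1.
  by rewrite (cfInd_irr_irr sA1A) ?cfInd_char ?irr_char ?Ea_b1 ?mem_irr.
have a1b1: b1 \in irr_constt ('Res[B1] 'chi_a1).
  by rewrite -constt_Ind_Res Ea1 constt_irr inE.
have sDB1 := subset_trans sDC1 sC1B1.
have a1d: d \in irr_constt ('Res[D] 'chi_a1).
  rewrite -(cfResRes _ sDB1 sB1A1).
  exact: constt_Res_trans (cfRes_char B1 (irr_char a1)) a1b1 _ b1d.
have stepA: clifford_step N (mk_pair a) (mk_pair a1).
  by apply: (@clifford_stepI N A A1 D a a1 d) => //; rewrite -Ea1.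
have stepB: clifford_step N (mk_pair b) (mk_pair b1).
  exact: (@clifford_stepI N B B1 D b b1 d).
(* Any such [c1] is the Clifford correspondent of [c] over [d], because [B] fixes ['chi_c] and so
   ['chi_b] restricts to a multiple of it. *)
have [c1 b1c1] := constt_cfRes_irr C1 b1.
have nsDB1: D <| B1 := normalS sDB1 sB1B nsDB.
have c1d: d \in irr_constt ('Res[D] 'chi_c1).
  by apply: constt_Res_invariant b1c1; rewrite // subsetIr.
have cc1: c1 \in irr_constt ('Res[C1] 'chi_c).
  have: c1 \in irr_constt ('Res[C1] ('Res[C] 'chi_b)).
    rewrite cfResRes ?subsetIl // -(cfResRes _ sC1B1 sB1B).
    apply: constt_Res_trans b1c1; rewrite ?cfRes_char ?irr_char //.
    by rewrite -constt_Ind_Res Eb constt_irr inE.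
  rewrite (Res_invariant_constt nsCB _ bc) ?defB ?subsetIr //.
  by rewrite linearZ !irr_consttE cfdotZl mulf_eq0 negb_or => /andP[].
have Ec: 'Ind[C] 'chi_c1 = 'chi_c.
  have [irrInd _ _ _ _] := constt_Inertia_bijection d nsDC.
  have /irrInd/irrP[k Ek]: c1 \in irr_constt ('Ind[C1] 'chi_d).
    by rewrite constt_Ind_Res.
  by move: cc1; rewrite -constt_Ind_Res Ek constt_irr inE => /eqP->.
have defB1: B1 :=: 'I_A1['chi_c1].
  by rewrite /= (Inertia_Clifford_correspondent nsCA nsDA sDC c1d Ec) defB.
have VA1 := clifford_step_vertex VP stepA.
pose N1 := (A1 :&: N)%G.
have nsN1A1: N1 <| A1.
  rewrite /normal subsetIl normsI ?normG //.
  by rewrite (subset_trans sA1A) ?(subset_trans sAG).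
(* Irreducibility of [chi] on [N] passes to each vertex: [a1] stays irreducible on [A1 :&: N], so
   the reduced case applies inside [A1]. *)
have irr_N1: 'Res[N1] ('Ind[A1] 'chi_b1) \in irr N1.
  rewrite Ea1; have := VA1; rewrite inE => /andP[/= sA1G /eqP /= Echi1].
  by have [] := @cfInd_Res_normal_irr gT G N A1 a1 nsNG sA1G; rewrite ?Echi1.
have nsC1A1: C1 <| A1.
  rewrite /normal setSI //= normsI ?(subset_trans sA1A nCA) //.
  exact: subset_trans (subsetIr _ _) (normG _).
have defD: C1 :&: N1 = D.
  apply/eqP; rewrite eqEsubset setISS ?subsetIl ?subsetIr //=.
  apply/subsetIP; split=> //; apply/subsetIP; split=> //.
  exact: subset_trans sDB1 sB1A1.
have [nsSA1 /irrP[s Es] Is] :=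
  Inertia_Res_invariant nsN1A1 nsC1A1 defD defB1 (subsetIr _ _) c1d irr_N1.
have b1s: s \in irr_constt ('Res[B1 :&: N1] 'chi_b1).
  by rewrite Es constt_irr inE.
have stepC: clifford_step N (mk_pair a1) (mk_pair b1).
  apply: (@clifford_stepI N A1 B1 (B1 :&: N1)%G a1 b1 s) => //.
  - by rewrite subIset // subsetIr orbT.
  - by rewrite -Es Is.
  rewrite -(cfResRes _ _ sB1A1) ?subsetIl //.
  exact: constt_Res_trans (cfRes_char B1 (irr_char a1)) a1b1 _ b1s.
have VB: mk_pair b \in clifford_vertices chi.
  by rewrite inE /= (subset_trans sBA) //= -(cfIndInd _ sAG sBA) Ea Echi.
apply: connect_trans (connect_clifford_step VP stepA) _.
apply: connect_trans (connect_clifford_step VA1 stepC) _.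
rewrite (sym_connect_sym (clifford_graph_sym N chi)).
exact: connect_clifford_step VB stepB.
Qed.

End CliffordGraph.

Theorem theoremA (gT : finGroupType) (G N : {group gT}) (chi : 'CF(G))
    (irr_chi : chi \in irr G) (nsNG : N <| G)
    (irr_chiN : 'Res[N] chi \in irr N) (P Q : char_pair gT)
    (PV : P \in clifford_vertices chi) (QV : Q \in clifford_vertices chi) :
  connect (clifford_graph chi G) P Q <-> connect (clifford_graph chi N) P Q.
Proof.
have sNG := normal_sub nsNG.
split; apply: connect_sub => {PV QV}P {}Q /and4P[PV QV neqPQ].
  case/orP=> [PQ | QP]; first exact: clifford_step_connect PQ.
  rewrite (sym_connect_sym (clifford_graph_sym N chi)).
  exact: clifford_step_connect QP.
move=> PQ; rewrite connect1 // /clifford_graph PV QV neqPQ /=.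
by case/orP: PQ => /(clifford_step_subset sNG)->; rewrite ?orbT.
Qed.
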